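(* There is a constant $c$ such that the following holds. Let $\mathcal{E}$ be a set of extension axioms and $\Gamma \to \Delta$ a sequent of eNDT formulas. If $\mathsf{eLNDT}$ has a proof of size $N$ of $\Gamma \to \Delta$ over $\mathcal{E}$, then in the game $\mathsf{NB}$ over $\mathcal{E}$ there is a winning strategy for Prover from the state $\{\Gamma \mapsto 1, \Delta \mapsto 0\}$ with at most $c\log N$ rounds (for $N\ge 2$), i.e.\ $O(\log N)$ rounds. Likewise, if $\mathcal{E}$ is $\lor$-free, $\Gamma\to\Delta$ consists of eDT formulas, and $\mathsf{eLDT}$ has a proof of size $N$ of $\Gamma\to\Delta$ over $\mathcal{E}$, then there is an $O(\log N)$-round winning strategy from $\{\Gamma \mapsto 1, \Delta \mapsto 0\}$ in the game $\mathsf{DB}$ over $\mathcal{E}$.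
   Context: Syntax. Fix propositional variables $p,q,\dots$ and a disjoint set of extension variables $e_0,e_1,\dots$. eNDT formulas are generated by $A,B ::= 0 \mid 1 \mid ApB \mid A\lor B \mid e_i$, where in $ApB$ the symbol $p$ is a propositional variable ($ApB$ means ''if $p$ then $B$ else $A$''). eDT formulas are eNDT formulas without $\lor$. A propositional variable $p$ is identified with the formula $0p1$. A set of extension axioms is a set $\mathcal{E}=\{e_i\leftrightarrow E_i\}_{i<n}$ where each $E_i$ is an eNDT formula containing only extension variables among $e_0,\dots,e_{i-1}$; it is $\lor$-free if all $E_i$ are eDT. A sequent $\Gamma\to\Delta$ is a pair of finite lists of formulas. Proof systems. $\mathsf{LNDT}$ has the rules: identity $A\to A$; cut (from $\Gamma\to\Delta,A$ and $\Gamma,A\to\Delta$ infer $\Gamma\to\Delta$); exchange, weakening and contraction on both sides; axiom $0\to$; from $\Gamma\to\Delta$ infer $\Gamma,1\to\Delta$; from $\Gamma\to\Delta$ infer $\Gamma\to\Delta,0$; axiom $\to 1$; $\lor$-left (from $\Gamma,A\to\Delta$ and $\Gamma,B\to\Delta$ infer $\Gamma,A\lor B\to\Delta$); $\lor$-right (from $\Gamma\to\Delta,A,B$ infer $\Gamma\to\Delta,A\lor B$); $p$-left (from $\Gamma,A\to\Delta,p$ and $\Gamma,p,B\to\Delta$ infer $\Gamma,ApB\to\Delta$); $p$-right (from $\Gamma\to\Delta,A,p$ and $\Gamma,p\to\Delta,B$ infer $\Gamma\to\Delta,ApB$). $\mathsf{LDT}$ is $\mathsf{LNDT}$ without the $\lor$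 rules. An $\mathsf{eLNDT}$ (resp.\ $\mathsf{eLDT}$) proof of $\Gamma\to\Delta$ over $\mathcal{E}$ is a finite list of sequents ending in $\Gamma\to\Delta$, each of which is either a hypothesis $e_i\to E_i$ or $E_i\to e_i$ for $(e_i\leftrightarrow E_i)\in\mathcal{E}$, or follows from earlier sequents by a rule of $\mathsf{LNDT}$ (resp.\ $\mathsf{LDT}$). Its size is the number of symbols occurring in it. Simulation. For $\mathcal{E}=\{e_i\leftrightarrow E_i\}_{i<n}$, the relation $A\succeq_{\mathcal{E}} B$ on eNDT formulas is the smallest relation such that: $A\succeq_\mathcal{E} A$; if $A\succeq_\mathcal{E} C$ and $A\succeq_\mathcal{E} D$ then $A\succeq_\mathcal{E} C\lor D$; if $A\succeq_\mathcal{E} E_i$ then $A\succeq_\mathcal{E} e_i$; if $A\succeq_\mathcal{E} C$ and $B\succeq_\mathcal{E} D$ then $ApB\succeq_\mathcal{E} CpD$; if $A_j\succeq_\mathcal{E} B$ for some $j\in\{0,1\}$ then $A_0\lor A_1\succeq_\mathcal{E} B$; if $E_i\succeq_\mathcal{E} B$ then $e_i\succeq_\mathcal{E} B$. Games. Queries of $\mathsf{NB}$ are Boolean combinations of eNDT formulas: $P,Q ::= A \mid \neg Q \mid Q\lor R\mid Q\land R$ with $A$ an eNDT formula; queries of $\mathsf{DB}$ are the same with $A$ ranging over eDT formulas. A state is a set of assignments $Q\mapsto b$ ($b\in\{0,1\}$). Simple contradictions (over $\mathcal{E}$) are the sets: $\{0\mapsto1\}$, $\{1\mapsto0\}$; $\{A_0\mapsto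 b_0, A_1\mapsto b_1, p\mapsto i, A_0pA_1\mapsto c\}$ with $c\ne b_i$; every set inconsistent with the truth tables of $\neg,\lor,\land$, namely $\{Q\mapsto b,\neg Q\mapsto b\}$, $\{Q_0\lor Q_1\mapsto 0, Q_i\mapsto1\}$, $\{Q_0\lor Q_1\mapsto1,Q_0\mapsto0,Q_1\mapsto0\}$, $\{Q_0\land Q_1\mapsto0,Q_0\mapsto1,Q_1\mapsto1\}$, $\{Q_0\land Q_1\mapsto1,Q_i\mapsto0\}$; $\{e_i\mapsto b, E_i\mapsto 1-b\}$ for $(e_i\leftrightarrow E_i)\in\mathcal{E}$; and $\{A\mapsto0, B\mapsto1\}$ whenever $A\succeq_\mathcal{E} B$. In a play, Prover asks queries and Adversary assigns them values in $\{0,1\}$; Prover wins once the initial state together with Adversary's answers contains a simple contradiction. A winning strategy from state $S$ is a finite binary tree whose internal nodes are labelled by queries, with the two outgoing edges labelled $0$ and $1$, such that for each root-to-leaf path, $S$ together with the assignments (query at node $\mapsto$ label of the edge taken) contains a simple contradiction. The number of rounds is the depth of the tree. *)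

(* Defs.v *)
From HB Require Import structures.
From mathcomp Require Import all_boot.

Set Implicit Arguments.
Unset Strict Implicit.
Unset Printing Implicit Defensive.

(* eNDT formulas; [FDec A p B] is ApB, i.e. "if p then B else A". *)
Inductive form : Type :=
| F0
| F1
| FDec of form & nat & form
| FOr of form & form
| FExt of nat.

Lemma form_eq_dec : comparable form.
Proof. by rewrite /comparable /decidable; do 2! decide equality. Defined.
HB.instance Definition _ := comparableMixin form_eq_dec.

Definition FVar (p : nat) : form := FDec F0 p F1.

Fixpoint eDT (A : form) : bool :=
  match A with
  | F0 | F1 | FExt _ => true
  | FDec B _ C => eDT B && eDT C
  | FOr _ _ => false
  end.

(* All extension variables of A are among e_0, ..., e_{n-1}. *)
Fixpoint ext_below (n : nat) (A : form) : bool :=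
  match A with
  | F0 | F1 => true
  | FExt i => i < n
  | FDec B _ C | FOr B C => ext_below n B && ext_below n C
  end.

(* The list E_0, ..., E_{n-1} stands for the set {e_i <-> E_i}_{i < n}. *)
Definition ext_axioms (E : seq form) : Prop :=
  forall i, i < size E -> ext_below i (nth F0 E i).

Definition sequent : Type := (seq form * seq form)%type.

(* [LDT ps S]: S follows from the premises ps by one inference.
   The comma notation "Gamma, A" is [rcons Gamma A]. *)
Inductive LDT : seq sequent -> sequent -> Prop :=
| LDT_id A : LDT [::] ([:: A], [:: A])
| LDT_cut G D A :
    LDT [:: (G, rcons D A); (rcons G A, D)] (G, D)
| LDT_exchl G G' D A B :
    LDT [:: (G ++ [:: A, B & G'], D)] (G ++ [:: B, A & G'], D)
| LDT_exchr G D D' A B :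
    LDT [:: (G, D ++ [:: A, B & D'])] (G, D ++ [:: B, A & D'])
| LDT_weakl G D A : LDT [:: (G, D)] (rcons G A, D)
| LDT_weakr G D A : LDT [:: (G, D)] (G, rcons D A)
| LDT_contrl G D A : LDT [:: (rcons (rcons G A) A, D)] (rcons G A, D)
| LDT_contrr G D A : LDT [:: (G, rcons (rcons D A) A)] (G, rcons D A)
| LDT_0l : LDT [::] ([:: F0], [::])
| LDT_1l G D : LDT [:: (G, D)] (rcons G F1, D)
| LDT_0r G D : LDT [:: (G, D)] (G, rcons D F0)
| LDT_1r : LDT [::] ([::], [:: F1])
| LDT_pl G D A p B :
    LDT [:: (rcons G A, rcons D (FVar p)); (rcons (rcons G (FVar p)) B, D)]
        (rcons G (FDec A p B), D)
| LDT_pr G D A p B :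
    LDT [:: (G, rcons (rcons D A) (FVar p)); (rcons G (FVar p), rcons D B)]
        (G, rcons D (FDec A p B)).

Inductive LNDT : seq sequent -> sequent -> Prop :=
| LNDT_LDT ps S : LDT ps S -> LNDT ps S
| LNDT_orl G D A B :
    LNDT [:: (rcons G A, D); (rcons G B, D)] (rcons G (FOr A B), D)
| LNDT_orr G D A B :
    LNDT [:: (G, rcons (rcons D A) B)] (G, rcons D (FOr A B)).

Inductive ext_hyp (E : seq form) : sequent -> Prop :=
| ext_hypl i : i < size E -> ext_hyp E ([:: FExt i], [:: nth F0 E i])
| ext_hypr i : i < size E -> ext_hyp E ([:: nth F0 E i], [:: FExt i]).

Definition ext_proof (rule : seq sequent -> sequent -> Prop)
    (E : seq form) (S : sequent) (pi : seq sequent) : Prop :=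
  (exists pi', pi = rcons pi' S) /\
  (forall pi1 T pi2, pi = pi1 ++ T :: pi2 ->
     ext_hyp E T \/ exists2 ps, {subset ps <= pi1} & rule ps T).

Definition eLNDT_proof := ext_proof LNDT.
Definition eLDT_proof := ext_proof LDT.

Fixpoint form_size (A : form) : nat :=
  match A with
  | F0 | F1 | FExt _ => 1
  | FDec B _ C | FOr B C => form_size B + 1 + form_size C
  end.

(* The summand 1 counts the sequent arrow; commas are not counted. *)
Definition sequent_size (S : sequent) : nat :=
  \sum_(A <- S.1) form_size A + 1 + \sum_(A <- S.2) form_size A.

Definition proof_size (pi : seq sequent) : nat :=
  \sum_(S <- pi) sequent_size S.

(* [sim E A B] is A >=_E B; A is then a consequence of B. *)
Inductive sim (E : seq form) : form -> form -> Prop :=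
| sim_refl A : sim E A A
| sim_orr A C D : sim E A C -> sim E A D -> sim E A (FOr C D)
| sim_extr A i : i < size E -> sim E A (nth F0 E i) -> sim E A (FExt i)
| sim_dec A B C D p :
    sim E A C -> sim E B D -> sim E (FDec A p B) (FDec C p D)
| sim_orl0 A0 A1 B : sim E A0 B -> sim E (FOr A0 A1) B
| sim_orl1 A0 A1 B : sim E A1 B -> sim E (FOr A0 A1) B
| sim_extl i B : i < size E -> sim E (nth F0 E i) B -> sim E (FExt i) B.

Inductive query : Type :=
| QAtom of form
| QNeg of query
| QOr of query & query
| QAnd of query & query.

Lemma query_eq_dec : comparable query.
Proof.
rewrite /comparable /decidable; decide equality; exact: form_eq_dec.
Defined.
HB.instance Definition _ := comparableMixin query_eq_dec.

(* Formulas and queries share the connective "or": the eNDT formula A \/ B,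
   read as a query, is the disjunction of the queries A and B.  Hence [QAtom]
   is meant only for formulas that are not disjunctions, and formulas enter
   queries through [qform]. *)
Fixpoint qform (A : form) : query :=
  if A is FOr B C then QOr (qform B) (qform C) else QAtom A.

(* Boolean combinations of formulas satisfying P; this excludes [QAtom] of a
   disjunction. *)
Inductive is_query (P : pred form) : query -> Prop :=
| is_query_form A : P A -> is_query P (qform A)
| is_query_neg Q : is_query P Q -> is_query P (QNeg Q)
| is_query_or Q R : is_query P Q -> is_query P R -> is_query P (QOr Q R)
| is_query_and Q R : is_query P Q -> is_query P R -> is_query P (QAnd Q R).

(* States and contradictions are finite sets of assignments, given as lists
   and only ever used through membership; (Q, b) is the assignment of b to Q. *)
Definition state : Type := seq (query * bool).

Inductive simple_contradiction (E : seq form) : state -> Prop :=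
| sc_0 : simple_contradiction E [:: (qform F0, true)]
| sc_1 : simple_contradiction E [:: (qform F1, false)]
| sc_dec A0 A1 p (b0 b1 i c : bool) :
    c != (if i then b1 else b0) ->
    simple_contradiction E
      [:: (qform A0, b0); (qform A1, b1); (qform (FVar p), i);
          (qform (FDec A0 p A1), c)]
| sc_neg Q b : simple_contradiction E [:: (Q, b); (QNeg Q, b)]
| sc_or0l Q0 Q1 : simple_contradiction E [:: (QOr Q0 Q1, false); (Q0, true)]
| sc_or0r Q0 Q1 : simple_contradiction E [:: (QOr Q0 Q1, false); (Q1, true)]
| sc_or1 Q0 Q1 :
    simple_contradiction E [:: (QOr Q0 Q1, true); (Q0, false); (Q1, false)]
| sc_and0 Q0 Q1 :
    simple_contradiction E [:: (QAnd Q0 Q1, false); (Q0, true); (Q1, true)]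
| sc_and1l Q0 Q1 : simple_contradiction E [:: (QAnd Q0 Q1, true); (Q0, false)]
| sc_and1r Q0 Q1 : simple_contradiction E [:: (QAnd Q0 Q1, true); (Q1, false)]
| sc_ext i b : i < size E ->
    simple_contradiction E [:: (qform (FExt i), b); (qform (nth F0 E i), ~~ b)]
| sc_sim A B : sim E A B ->
    simple_contradiction E [:: (qform A, false); (qform B, true)].

(* In [Node Q t0 t1], the edge to t0 is labelled 0 and the edge to t1 is
   labelled 1. *)
Inductive strategy : Type :=
| Leaf
| Node of query & strategy & strategy.

Fixpoint depth (t : strategy) : nat :=
  if t is Node _ t0 t1 then (maxn (depth t0) (depth t1)).+1 else 0.

Fixpoint labels (t : strategy) : seq query :=
  if t is Node Q t0 t1 then Q :: labels t0 ++ labels t1 else [::].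

(* The sets of assignments along the root-to-leaf paths. *)
Fixpoint branches (t : strategy) : seq state :=
  if t is Node Q t0 t1 then
    [seq (Q, false) :: s | s <- branches t0] ++
    [seq (Q, true) :: s | s <- branches t1]
  else [:: [::]].

Definition winning (P : pred form) (E : seq form) (S : state) (t : strategy)
  : Prop :=
  (forall Q, Q \in labels t -> is_query P Q) /\
  (forall s, s \in branches t ->
     exists2 C, simple_contradiction E C & {subset C <= S ++ s}).

Definition NB_winning := winning predT.
Definition DB_winning := winning eDT.

Definition initial_state (G D : seq form) : state :=
  [seq (qform A, true) | A <- G] ++ [seq (qform A, false) | A <- D].

(* Main.v *)
Require Import Defs.
From Stdlib Require Import Reals Lra.
From mathcomp Require Import all_boot zify.

Set Implicit Arguments.
Unset Strict Implicit.
Unset Printing Implicit Defensive.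

Delimit Scope R_scope with R.

(** Read each line of the proof as the disjunction of its literals, and ask for
    the prefixes of the conjunction of all lines.  Bisection on these nested
    prefixes yields, in logarithmically many rounds, a false line all of whose
    predecessors are jointly true.  Bisection on prefixes again forces its
    premises to be true, picks a true literal of each premise, and forces the
    literals of the false line to be false; the inference is then refuted on
    its principal formulas in a bounded number of rounds.  A formula [A \/ B]
    has no rule of its own in LDT, so replacing every disjunction by [0]
    turns any eLDT proof into one consisting of eDT formulas. *)

(** * Winning in a bounded number of rounds *)

(** Working on states directly spares the arguments below all handling of trees and branches;
    [wins_strategy] recovers the tree. A leaf is accepted at every [n], so [n] is only an upper
    bound. *)
Inductive wins (P : pred form) (E : seq form) : nat -> state -> Prop :=
| wins_leaf n S C :
    simple_contradiction E C -> {subset C <= S} -> wins P E n S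
| wins_ask n S Q :
    is_query P Q -> wins P E n ((Q, false) :: S) ->
    wins P E n ((Q, true) :: S) -> wins P E n.+1 S.

Lemma wins_strategy P E n S :
  wins P E n S -> exists2 t, winning P E S t & depth t <= n.
Proof.
elim=> {n S} [n S C scC sCS|n S Q qQ _ [t0 [q0 w0] d0] _ [t1 [q1 w1] d1]].
  exists Leaf => //; split=> // s; rewrite inE => /eqP->.
  by exists C => // x /sCS; rewrite cats0.
exists (Node Q t0 t1); last by rewrite /= ltnS geq_max d0.
split=> [R|s] /=.
  by rewrite inE mem_cat => /or3P[/eqP->|/q0|/q1].
by rewrite mem_cat => /orP[] /mapP[s' s'in ->];
  [have [C scC sC] := w0 _ s'in | have [C scC sC] := w1 _ s'in];
  exists C => // x /sC; rewrite !(mem_cat, inE) orbCA orbA.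
Qed.

Lemma wins_sub P E m n S S' :
  wins P E m S -> {subset S <= S'} -> m <= n -> wins P E n S'.
Proof.
move=> w; elim: w n S' => {m S} [m S C scC sCS|m S Q qQ _ IH0 _ IH1] n S' sS.
  by move=> _; apply: (@wins_leaf _ _ _ _ _ scC) => x /sCS/sS.
case: n => // n; rewrite ltnS => le_mn.
by apply: (wins_ask qQ); [apply: IH0 | apply: IH1] => // x;
  rewrite !inE => /orP[->//|/sS->]; rewrite orbT.
Qed.

Lemma wins_le P E m n S : m <= n -> wins P E m S -> wins P E n S.
Proof. by move=> le_mn w; apply: wins_sub w _ _. Qed.

Lemma subset_consr (T : eqType) (s : seq T) x : {subset s <= x :: s}.
Proof. by move=> y; rewrite inE orbC => ->. Qed.

Ltac in_state :=
  by repeat first [assumption | exact: mem_head | apply: subset_consr].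

Lemma subset_cons (T : eqType) (s s' : seq T) x :
  x \in s' -> {subset s <= s'} -> {subset x :: s <= s'}.
Proof. by move=> xs' ss' y /predU1P[->|/ss']. Qed.

Ltac contradiction_by sc :=
  apply: (@wins_leaf _ _ _ _ _ sc);
  repeat (apply: subset_cons; [in_state|]); done.

(** [b] is the value of the unit: true for conjunctions, false for disjunctions. Folding from the
    left makes each prefix the left argument of the next one, and the leading constant gives the
    empty prefix a known value. *)
Definition junct (b : bool) : seq query -> query :=
  foldl (if b then QAnd else QOr) (qform (if b then F1 else F0)).

Definition lits (T : sequent) : seq query :=
  [seq QNeg (qform A) | A <- T.1] ++ [seq qform A | A <- T.2].

Definition line (T : sequent) : query := junct false (lits T).

Section Game.

Variables (P : pred form) (E : seq form) (k : nat).
Hypotheses (P0 : P F0) (P1 : P F1).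

Local Notation W := (wins P E).
Local Notation is_q := (is_query P).
(* Every derived move below costs a bounded number of units of [K] rounds. *)
Local Notation K := (k + 5).

(** * Elementary moves and bisection *)

(** The sign [b] fixes the order of the two answers, so that conjunctions and disjunctions can share
    one argument. *)
Lemma wins_case n S Q b : is_q Q ->
  W n ((Q, b) :: S) -> W n ((Q, ~~ b) :: S) -> W n.+1 S.
Proof. by case: b => qQ w0 w1; apply: (wins_ask qQ). Qed.

(** Opposite values of an arbitrary query need not form a simple contradiction. Asking the negation
    produces one, since either answer agrees with one of the two values of [Q]. *)
Lemma wins_clash n S Q b :
  is_q Q -> (Q, b) \in S -> (Q, ~~ b) \in S -> 0 < n -> W n S.
Proof.
case: n => // n qQ Qb QNb _; apply: (@wins_case _ _ (QNeg Q) b).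
- exact: is_query_neg.
- by contradiction_by (sc_neg E Q b).
- by contradiction_by (sc_neg E Q (~~ b)).
Qed.

(** A single question is charged a whole unit, which keeps budgets multiples of [K]. *)
Lemma wins_query j S Q : is_q Q ->
  (forall b, W (j * K) ((Q, b) :: S)) -> W (j.+1 * K) S.
Proof.
move=> qQ w; apply: (@wins_le _ _ (j * K).+1); first by lia.
exact: (wins_ask qQ).
Qed.

(** Whatever the value at the midpoint, one half still passes from [b] to [~~ b]; after at most [n]
    rounds its endpoints are adjacent. *)
Lemma wins_bisect b (f : nat -> query) r n S i j :
  (forall m, is_q (f m)) -> i < j -> j - i <= 2 ^ n ->
  (f i, b) \in S -> (f j, ~~ b) \in S ->
  (forall m S', m < j -> {subset S <= S'} ->
     (f m, b) \in S' -> (f m.+1, ~~ b) \in S' -> W r S') ->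
  W (n + r) S.
Proof.
move=> qf; elim: n S i j => [|n IH] S i j lt_ij; rewrite ?expnS => le_ij fi fj w.
  have eq_j : j = i.+1 by lia.
  rewrite eq_j in fj.
  by apply: (w i) => //; lia.
(* The interval may have length 1 while rounds are left; its midpoint would be [i] again, so nothing
   is asked. *)
have [le_ij1|lt_ij1] := leqP j i.+1.
  have eq_j : j = i.+1 by lia.
  rewrite eq_j in fj.
  by apply: (@wins_le _ _ r); [lia | apply: (w i)].
pose m := i + (j - i)./2.
have [lt_im lt_mj] : i < m /\ m < j by rewrite /m; lia.
rewrite addSn; apply: (@wins_case _ _ (f m) b) => //.
- apply: (IH _ m j) => //; [by rewrite /m; lia|exact: mem_head|in_state|].
  move=> m' S' lt_m'j sS; apply: w => // x xS.
  by apply: sS; rewrite inE xS orbT.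
- apply: (IH _ i m) => //; [by rewrite /m; lia|in_state|exact: mem_head|].
  move=> m' S' lt_m'm sS; apply: w => [|x xS]; first by lia.
  by apply: sS; rewrite inE xS orbT.
Qed.

(** * Bisection on prefixes of conjunctions and disjunctions *)

Lemma is_query_junct b s : {in s, forall Q, is_q Q} -> is_q (junct b s).
Proof.
elim/last_ind: s => [|s Q IH] qs.
  by rewrite /junct /=; apply: is_query_form; case: b.
have qQ : is_q Q by apply: qs; rewrite mem_rcons mem_head.
have {}IH : is_q (junct b s).
  by apply: IH => R Rs; apply: qs; rewrite mem_rcons inE Rs orbT.
by rewrite /junct foldl_rcons; case: b IH => IH; constructor.
Qed.

Lemma is_query_junct_take b s m :
  {in s, forall Q, is_q Q} -> is_q (junct b (take m s)).
Proof. by move=> qs; apply: is_query_junct => Q /mem_take/qs. Qed.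

Lemma junct_takeS b s m : m < size s ->
  junct b (take m.+1 s) =
  (if b then QAnd else QOr) (junct b (take m s)) (nth (qform F0) s m).
Proof. by move=> lt_ms; rewrite (take_nth (qform F0)) // /junct foldl_rcons. Qed.

(** This and the next two lemmas are the truth-table contradictions at one link of the chain of
    prefixes. *)
Lemma wins_juncts_l b s n S m : m < size s ->
  (junct b (take m s), ~~ b) \in S -> (junct b (take m.+1 s), b) \in S -> W n S.
Proof.
move=> lt_ms; rewrite junct_takeS //; case: b => /= ? ?.
- by contradiction_by (sc_and1l E (junct true (take m s)) (nth (qform F0) s m)).
- by contradiction_by (sc_or0l E (junct false (take m s)) (nth (qform F0) s m)).
Qed.

Lemma wins_juncts_r b s n S m : m < size s ->
  (nth (qform F0) s m, ~~ b) \in S -> (junct b (take m.+1 s), b) \in S -> W n S.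
Proof.
move=> lt_ms; rewrite junct_takeS //; case: b => /= ? ?.
- by contradiction_by (sc_and1r E (junct true (take m s)) (nth (qform F0) s m)).
- by contradiction_by (sc_or0r E (junct false (take m s)) (nth (qform F0) s m)).
Qed.

Lemma wins_juncts_i b s n S m : m < size s ->
  (junct b (take m s), b) \in S -> (nth (qform F0) s m, b) \in S ->
  (junct b (take m.+1 s), ~~ b) \in S -> W n S.
Proof.
move=> lt_ms; rewrite junct_takeS //; case: b => /= ? ? ?.
- by contradiction_by (sc_and0 E (junct true (take m s)) (nth (qform F0) s m)).
- by contradiction_by (sc_or1 E (junct false (take m s)) (nth (qform F0) s m)).
Qed.

Lemma wins_junct0 b n S : (junct b [::], ~~ b) \in S -> W n S.
Proof.
case: b => ?.
- by contradiction_by (sc_1 E).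
- by contradiction_by (sc_0 E).
Qed.

(** If [Q] gets the value [~~ b], so must the prefix ending in [Q], whereas the whole has value [b].
    Bisection between the two finds adjacent prefixes passing from [~~ b] to [b], which is
    impossible. *)
Lemma junct_force b s Q S j :
  {in s, forall R, is_q R} -> size s <= 2 ^ k ->
  (junct b s, b) \in S -> Q \in s ->
  W (j * K) ((Q, b) :: S) -> W (j.+1 * K) S.
Proof.
move=> qs le_s sb Qs w; pose m := index Q s.
have lt_ms : m < size s by rewrite index_mem.
have Qm : nth (qform F0) s m = Q by rewrite nth_index.
apply: (@wins_le _ _ (j * K + (k + 2)).+1); first by lia.
apply: (@wins_case _ _ Q b); first exact: qs.
  by apply: wins_sub w _ _ => //; lia.
rewrite (_ : _ + _ = (j * K + k + 1).+1); last by lia.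
apply: (@wins_case _ _ (junct b (take m.+1 s)) b).
- exact: is_query_junct_take.
- by apply: (@wins_juncts_r b s _ _ m) => //; rewrite ?Qm; in_state.
(* If the prefix through [Q] is all of [s], nothing is left to bisect and the two values clash. *)
have [lt_m1|ge_m1] := ltnP m.+1 (size s); last first.
  apply: (@wins_clash _ _ (junct b s) b); [exact: is_query_junct|in_state| |].
    by rewrite take_oversize //; exact: mem_head.
  by lia.
(* The final budget is 0 because the change of value between adjacent prefixes is itself a simple
   contradiction. *)
apply: (@wins_le _ _ (k + 0)); first by lia.
apply: (@wins_bisect (~~ b) (fun m => junct b (take m s)) 0 _ _ m.+1 (size s)).
- by move=> m'; apply: is_query_junct_take.
- exact: lt_m1.
- by lia.
- exact: mem_head.
- by rewrite take_size negbK; in_state.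
move=> m' S' lt_m's _ m1 m2.
by apply: (@wins_juncts_l b s _ _ m') => //; rewrite negbK in m2.
Qed.

(** The empty prefix has value [b] and the whole [~~ b]; where the value changes, the next entry
    must be [~~ b]. The value of the prefix before it is kept: for proof lines it says that all
    predecessors of the false line hold. *)
Lemma junct_find b s S j :
  {in s, forall R, is_q R} -> size s <= 2 ^ k ->
  (junct b s, ~~ b) \in S ->
  (forall i S', i < size s -> {subset S <= S'} ->
     (junct b (take i s), b) \in S' -> (nth (qform F0) s i, ~~ b) \in S' ->
     W (j * K) S') ->
  W (j.+1 * K) S.
Proof.
move=> qs le_s sb w.
apply: (@wins_le _ _ (k + (j * K).+1).+1); first by lia.
apply: (@wins_case _ _ (junct b [::]) b); first exact: is_query_junct.
- have [s0|s_gt0] := posnP (size s).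
    apply: (@wins_clash _ _ (junct b s) b); [exact: is_query_junct| |in_state|].
      by rewrite (size0nil s0) mem_head.
    by lia.
  apply: (@wins_bisect b (fun m => junct b (take m s)) _ _ _ 0 (size s)).
  + by move=> m; apply: is_query_junct_take.
  + exact: s_gt0.
  + by lia.
  + by rewrite take0 mem_head.
  + by rewrite take_size; in_state.
  move=> m S' lt_m sS m0 m1.
  apply: (@wins_case _ _ (nth (qform F0) s m) b).
  + by apply: qs; exact: mem_nth.
  + by apply: (@wins_juncts_i b s _ _ m) => //; in_state.
  + apply: (w m) => //; [|in_state|exact: mem_head].
    by move=> x xS; apply/subset_consr/sS/subset_consr.
- by apply: (@wins_junct0 b); exact: mem_head.
Qed.

(** * Sequents as disjunctions of literals *)

Definition fits (T : sequent) : Prop :=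
  {in T.1 ++ T.2, forall A, P A} /\ size T.1 + size T.2 <= 2 ^ k.

Lemma fits_query T A : fits T -> (A \in T.1) || (A \in T.2) -> is_q (qform A).
Proof. by case=> PT _ AT; apply/is_query_form/PT; rewrite mem_cat. Qed.

Lemma lits_query T : fits T -> {in lits T, forall Q, is_q Q}.
Proof.
move=> fT Q; rewrite mem_cat => /orP[] /mapP[A AT ->].
  by apply/is_query_neg/(fits_query fT); rewrite AT.
by apply: (fits_query fT); rewrite AT orbT.
Qed.

Lemma size_lits T : fits T -> size (lits T) <= 2 ^ k.
Proof. by case=> _; rewrite size_cat !size_map. Qed.

(** The literal is the negation of [A]; compared with [line_false_r], the extra unit pays for asking
    [A] itself. *)
Lemma line_false_l T S A j : fits T -> (line T, false) \in S -> A \in T.1 ->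
  W (j * K) ((qform A, true) :: S) -> W (j.+2 * K) S.
Proof.
move=> fT vT AT w.
apply: (@junct_force false (lits T) (QNeg (qform A))) => //.
- exact: lits_query.
- exact: size_lits.
- by rewrite mem_cat map_f.
apply: (@wins_query _ _ (qform A)); first by apply: (fits_query fT); rewrite AT.
case; last by contradiction_by (sc_neg E (qform A) false).
by apply: wins_sub w _ _ => // x; rewrite !inE => /orP[->|->]; rewrite ?orbT.
Qed.

Lemma line_false_r T S A j : fits T -> (line T, false) \in S -> A \in T.2 ->
  W (j * K) ((qform A, false) :: S) -> W (j.+1 * K) S.
Proof.
move=> fT vT AT; apply: (@junct_force false (lits T) (qform A)) => //.
- exact: lits_query.
- exact: size_lits.
- by rewrite mem_cat orbC map_f.
Qed.

Lemma line_true T S j : fits T -> (line T, true) \in S ->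
  {in T.1, forall A S', {subset S <= S'} -> (qform A, false) \in S' ->
     W (j * K) S'} ->
  {in T.2, forall A S', {subset S <= S'} -> (qform A, true) \in S' ->
     W (j * K) S'} ->
  W (j.+2 * K) S.
Proof.
move=> fT vT wl wr.
apply: (@junct_find false (lits T)) => //.
- exact: lits_query.
- exact: size_lits.
move=> i S' /(mem_nth (qform F0)) iT sS _; move: iT; set Q := nth _ _ _.
rewrite mem_cat => /orP[] /mapP[A AT ->] QS.
  apply: (@wins_query _ _ (qform A)); first by apply: (fits_query fT); rewrite AT.
  case; first by contradiction_by (sc_neg E (qform A) true).
  by apply: (wl A) => // [x xS|]; [apply/subset_consr/sS | exact: mem_head].
apply: (@wins_le _ _ (j * K)); first by lia.
exact: (wr A).
Qed.

(** A true premise [T'] has a true literal. If its formula comes from the conclusion [T], falsity of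
    [T] forces the opposite value; only the active formulas [X] remain for the caller. Since
    contexts are compared as sets, [X] is empty for structural rules. The 5 units are 2 to find the
    literal, at most 2 to force the opposite value, and 1 for the clash. *)
Lemma premise T T' X S j : fits T -> fits T' ->
  (line T, false) \in S -> (line T', true) \in S ->
  {subset T'.1 <= T.1 ++ X.1} -> {subset T'.2 <= T.2 ++ X.2} ->
  {in X.1, forall A, W (j * K) ((qform A, false) :: S)} ->
  {in X.2, forall A, W (j * K) ((qform A, true) :: S)} ->
  W (j.+1.+4 * K) S.
Proof.
move=> fT fT' vT vT' s1 s2 wl wr.
apply: (line_true fT' vT') => A AT' S' sS AS'; have vTS' := sS _ vT.
- have := s1 _ AT'; rewrite mem_cat => /orP[AT|AX].
    apply: (line_false_l fT vTS' AT).
    apply: (@wins_clash _ _ (qform A) true); [|exact: mem_head|in_state|by lia].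
    by apply: (fits_query fT); rewrite AT.
  by apply: wins_sub (wl _ AX) _ _; last (by lia); move=> x /predU1P[->|/sS].
- have := s2 _ AT'; rewrite mem_cat => /orP[AT|AX].
    apply: (line_false_r fT vTS' AT).
    apply: (@wins_clash _ _ (qform A) false); [|exact: mem_head|in_state|by lia].
    by apply: (fits_query fT); rewrite AT orbT.
  by apply: wins_sub (wr _ AX) _ _; last (by lia); move=> x /predU1P[->|/sS].
Qed.

(** * Refuting a single inference *)

(** For formulas, reflexivity of simulation makes the clash a simple contradiction, at no cost in
    rounds. *)
Lemma wins_formula_clash n S A : (qform A, true) \in S ->
  (qform A, false) \in S -> W n S.
Proof. by move=> ? ?; contradiction_by (sc_sim (sim_refl E A)). Qed.

Lemma wins_dec n S A B p (a b i c : bool) : c != (if i then b else a) ->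
  (qform A, a) \in S -> (qform B, b) \in S -> (qform (FVar p), i) \in S ->
  (qform (FDec A p B), c) \in S -> W n S.
Proof. by move=> cP ? ? ? ?; contradiction_by (sc_dec E A B p cP). Qed.

Local Ltac fits_premise := by
  match goal with H : forall T, _ -> fits T /\ _ |- _ =>
    apply: (proj1 (H _ _)); rewrite ?inE ?eqxx ?orbT end.
Local Ltac premise_true := by
  repeat apply: subset_consr;
  match goal with H : forall T, _ -> fits T /\ _ |- _ =>
    apply: (proj2 (H _ _)); rewrite ?inE ?eqxx ?orbT end.
Local Ltac context_sub := by
  let x := fresh "x" in move=> x /=; rewrite !(mem_rcons, mem_cat, inE);
  repeat match goal with
  | |- context [x \in ?G] => case: (x \in G)
  | |- context [x == ?A] => case: (x == A) end.
Local Ltac use_premise fT T' X :=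
  apply: (@premise _ T' X _ _ fT);
  [fits_premise | in_state | premise_true | context_sub | context_sub
  | move=> ?; rewrite ?inE /=; try (move=> /eqP->)
  | move=> ?; rewrite ?inE /=; try (move=> /eqP->)]; try done.

(** Either the values violate the truth table of the decision, or one of [a], [b], [i] is opposite
    to a value obtained for the same formula from a premise. *)
Local Ltac refute_dec A B p a b i c :=
  have [?|] := boolP (c != if i then b else a);
  [ by apply: (@wins_dec _ _ A B p a b i c); in_state
  | destruct a, b, i => // _;
    first [ by apply: (@wins_formula_clash _ _ A); in_state
          | by apply: (@wins_formula_clash _ _ B); in_state
          | by apply: (@wins_formula_clash _ _ (FVar p)); in_state ] ].

(** The dearest case is [LDT_pl]: 2 units for the principal formula, 3 for questions and 5 for each
    premise, 15 in all. The explicit numbers in the script are the units left after a move. *)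
Lemma LDT_refuted ps T S : LDT ps T -> fits T -> (line T, false) \in S ->
  (forall T', T' \in ps -> fits T' /\ (line T', true) \in S) -> W (20 * K) S.
Proof.
case=> {ps T} [A|G D A|G G' D A B|G D D' A B|G D A|G D A|G D A|G D A||G D|G D|
               |G D A p B|G D A p B] fT vT ps.
- apply: (@line_false_l _ _ A 18 fT vT); first exact: mem_head.
  apply: (@line_false_r _ _ A 17 fT); [in_state|exact: mem_head|].
  by apply: (@wins_formula_clash _ _ A); in_state.
- use_premise fT (G, rcons D A) (@nil form, [:: A]).
  use_premise fT (rcons G A, D) ([:: A], @nil form).
  by apply: (@wins_formula_clash _ _ A); in_state.
- use_premise fT (G ++ [:: A, B & G'], D) (@nil form, @nil form).
- use_premise fT (G, D ++ [:: A, B & D']) (@nil form, @nil form).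
- use_premise fT (G, D) (@nil form, @nil form).
- use_premise fT (G, D) (@nil form, @nil form).
- use_premise fT (rcons (rcons G A) A, D) (@nil form, @nil form).
- use_premise fT (G, rcons (rcons D A) A) (@nil form, @nil form).
- apply: (@line_false_l _ _ F0 18 fT vT); first exact: mem_head.
  by contradiction_by (sc_0 E).
- use_premise fT (G, D) (@nil form, @nil form).
- use_premise fT (G, D) (@nil form, @nil form).
- apply: (@line_false_r _ _ F1 19 fT vT); first exact: mem_head.
  by contradiction_by (sc_1 E).
- have f1 : fits (rcons G A, rcons D (FVar p)) by fits_premise.
  have f2 : fits (rcons (rcons G (FVar p)) B, D) by fits_premise.
  apply: (@line_false_l _ _ (FDec A p B) 18 fT vT).
    by rewrite mem_rcons mem_head.
  (* The contradiction for a decision needs the values of all three components, so they are asked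
     before the premises are used. *)
  apply: (@wins_query 17 _ (qform A)) => [|a].
    by apply: (fits_query f1); rewrite mem_rcons mem_head.
  apply: (@wins_query 16 _ (qform B)) => [|b].
    by apply: (fits_query f2); rewrite mem_rcons mem_head.
  apply: (@wins_query 15 _ (qform (FVar p))) => [|i].
    by apply: (fits_query f1); rewrite !mem_rcons mem_head orbT.
  (* The first premise leaves [A] false or [p] true, the second [p] false or [B] false; each
     combination contradicts that the decision is true. *)
  use_premise fT (rcons G A, rcons D (FVar p)) ([:: A], [:: FVar p]);
  use_premise fT (rcons (rcons G (FVar p)) B, D) ([:: FVar p; B], @nil form);
  case/pred2P=> ->; refute_dec A B p a b i true.
- have f1 : fits (G, rcons (rcons D A) (FVar p)) by fits_premise.
  have f2 : fits (rcons G (FVar p), rcons D B) by fits_premise.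
  apply: (@line_false_r _ _ (FDec A p B) 19 fT vT).
    by rewrite mem_rcons mem_head.
  apply: (@wins_query 18 _ (qform A)) => [|a].
    by apply: (fits_query f1); rewrite /= !(mem_rcons, inE) eqxx !orbT.
  apply: (@wins_query 17 _ (qform B)) => [|b].
    by apply: (fits_query f2); rewrite /= !(mem_rcons, inE) eqxx !orbT.
  apply: (@wins_query 16 _ (qform (FVar p))) => [|i].
    by apply: (fits_query f2); rewrite mem_rcons mem_head.
  use_premise fT (rcons G (FVar p), rcons D B) ([:: FVar p], [:: B]);
  use_premise fT (G, rcons (rcons D A) (FVar p)) (@nil form, [:: A; FVar p]);
  case/pred2P=> ->; refute_dec A B p a b i false.
Qed.

(** [qform] turns a disjunction of formulas into the disjunction of their queries, so the truth
    table of [QOr] settles both new rules. *)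
Lemma LNDT_refuted ps T S : LNDT ps T -> fits T -> (line T, false) \in S ->
  (forall T', T' \in ps -> fits T' /\ (line T', true) \in S) -> W (20 * K) S.
Proof.
case=> {ps T} [ps T|G D A B|G D A B]; first exact: LDT_refuted.
- move=> fT vT ps; apply: (@line_false_l _ _ (FOr A B) 18 fT vT).
    by rewrite mem_rcons mem_head.
  use_premise fT (rcons G A, D) ([:: A], @nil form).
  use_premise fT (rcons G B, D) ([:: B], @nil form).
  by contradiction_by (sc_or1 E (qform A) (qform B)).
- move=> fT vT ps; apply: (@line_false_r _ _ (FOr A B) 19 fT vT).
    by rewrite mem_rcons mem_head.
  use_premise fT (G, rcons (rcons D A) B) (@nil form, [:: A; B]).
  case/pred2P=> ->.
  + by contradiction_by (sc_or0l E (qform A) (qform B)).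
  + by contradiction_by (sc_or0r E (qform A) (qform B)).
Qed.

Lemma ext_hyp_refuted T S : ext_hyp E T -> fits T -> (line T, false) \in S ->
  W (20 * K) S.
Proof.
case=> {T} i lt_i fT vT.
- apply: (@line_false_l _ _ (FExt i) 18 fT vT); first exact: mem_head.
  apply: (@line_false_r _ _ (nth F0 E i) 17 fT); [in_state|exact: mem_head|].
  by contradiction_by (sc_ext true lt_i).
- apply: (@line_false_l _ _ (nth F0 E i) 18 fT vT); first exact: mem_head.
  apply: (@line_false_r _ _ (FExt i) 17 fT); [in_state|exact: mem_head|].
  by contradiction_by (sc_ext false lt_i).
Qed.

(** * Searching the proof *)

Lemma lines_force (pi ps : seq sequent) S j :
  {in pi, forall T, fits T} -> size pi <= 2 ^ k ->
  (junct true [seq line T | T <- pi], true) \in S -> {subset ps <= pi} ->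
  (forall S', {subset S <= S'} -> {in ps, forall T, (line T, true) \in S'} ->
     W (j * K) S') ->
  W ((size ps + j) * K) S.
Proof.
move=> fpi le_pi; elim: ps S => [|T ps IH] S piS sps w; first exact: w.
have Tpi : T \in pi by apply: sps; exact: mem_head.
apply: (@junct_force true [seq line T | T <- pi] (line T)).
- by move=> _ /mapP[T' T'pi ->]; apply/is_query_junct/lits_query/fpi.
- by rewrite size_map.
- exact: piS.
- exact: map_f.
apply: IH; [in_state|by move=> T' T'ps; apply/sps/subset_consr|].
move=> S' sS vps; apply: w => [x xS|T' /predU1P[->|/vps//]].
  exact/sS/subset_consr.
by apply: sS; exact: mem_head.
Qed.

Lemma LNDT_arity ps T : LNDT ps T -> size ps <= 2.
Proof. by case=> // {}ps {}T []. Qed.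

(** The 24 units are 1 to ask the conjunction of all lines, 1 to find a false line, at most 2 to
    force its premises, and 20 to refute the inference. If the conjunction is true, the end sequent
    is forced true, and its true literal clashes with the initial state. *)
Lemma ext_proof_wins G D pi : ext_proof LNDT E (G, D) pi ->
  {in pi, forall T, fits T} -> size pi <= 2 ^ k ->
  W (24 * K) (initial_state G D).
Proof.
case=> [[pi' def_pi] rule_pi] fpi le_pi.
have Tpi : (G, D) \in pi by rewrite def_pi mem_rcons mem_head.
have qpi : {in [seq line T | T <- pi], forall Q, is_q Q}.
  by move=> _ /mapP[T' T'pi ->]; apply/is_query_junct/lits_query/fpi.
apply: (@wins_query 23 _ (junct true [seq line T | T <- pi])).
  exact: is_query_junct.
case.
- apply: (@wins_le _ _ ((1 + 22) * K)) => //.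
  apply: (@lines_force pi [:: (G, D)]) => //; first exact: mem_head.
    by move=> T; rewrite inE => /eqP->.
  move=> S sS vS; apply: (@line_true (G, D)) => [|||A AD S' sS' AS'].
  + exact: fpi.
  + by apply: vS; exact: mem_head.
  + move=> A AG S' sS' AS'; apply: (@wins_formula_clash _ _ A) => //.
    apply/sS'/sS/subset_consr; rewrite mem_cat.
    by rewrite (map_f (fun A => (qform A, true)) AG).
  + apply: (@wins_formula_clash _ _ A) => //.
    apply/sS'/sS/subset_consr; rewrite mem_cat orbC.
    by rewrite (map_f (fun A => (qform A, false)) AD).
apply: (@junct_find true [seq line T | T <- pi]) => //.
- by rewrite size_map.
- exact: mem_head.
move=> i S; rewrite size_map => lt_i _ piS.
rewrite (nth_map (G, D)) //; set T := nth _ _ _ => vT.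
have fT : fits T by apply: fpi; exact: mem_nth.
(* Correctness of the proof at position [i] places the premises among the lines whose conjunction is
   already true. *)
have split_pi : pi = take i pi ++ T :: drop i.+1 pi.
  by rewrite -drop_nth // cat_take_drop.
have [hT|[ps sps rule_ps]] := rule_pi _ _ _ split_pi.
  by apply: (@wins_le _ _ (20 * K)); [lia | exact: (ext_hyp_refuted hT)].
have le_ps := LNDT_arity rule_ps.
apply: (@wins_le _ _ ((size ps + 20) * K)).
  by rewrite leq_mul2r (leq_add2r 20 _ 2) le_ps orbT.
apply: (@lines_force (take i pi)) => //.
- by move=> T' /mem_take/fpi.
- by rewrite size_take lt_i; lia.
- by rewrite map_take.
move=> S' sS vps; apply: (LNDT_refuted rule_ps fT (sS _ vT)) => T' T'ps.
by split; [apply/fpi/mem_take/sps | apply: vps].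
Qed.

End Game.

(** * Removing disjunctions from eLDT proofs *)

(** An eLDT proof may pass through disjunctions, for instance as cut formulas, and these are not
    queries of DB. *)
Fixpoint strip (A : form) : form :=
  match A with
  | FDec B p C => FDec (strip B) p (strip C)
  | FOr _ _ => F0
  | _ => A
  end.

Lemma eDT_strip A : eDT (strip A).
Proof. by elim: A => //= A -> p B ->. Qed.

Lemma strip_id A : eDT A -> strip A = A.
Proof. by elim: A => //= A IHA p B IHB /andP[/IHA-> /IHB->]. Qed.

Definition strip_sequent (T : sequent) : sequent :=
  (map strip T.1, map strip T.2).

(** [strip] commutes with decisions and fixes the constants, hence also [FVar p], and no rule of LDT
    has a disjunction as principal formula. Thus instances of rules go to instances of the same
    rules. *)
Lemma LDT_strip ps T :
  LDT ps T -> LDT (map strip_sequent ps) (strip_sequent T).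
Proof.
by case=> *; rewrite /strip_sequent /= ?(map_rcons, map_cat) /=; constructor.
Qed.

Lemma ext_hyp_strip E T :
  all eDT E -> ext_hyp E T -> ext_hyp E (strip_sequent T).
Proof.
move=> /allP eE [i lt_i|i lt_i]; rewrite /strip_sequent /= strip_id ?eE ?mem_nth //;
  by constructor.
Qed.

Lemma ext_proof_strip E T pi : all eDT E -> ext_proof LDT E T pi ->
  ext_proof LDT E (strip_sequent T) (map strip_sequent pi).
Proof.
move=> eE [[pi' ->] rule_pi]; split=> [|pi1 T' pi2 def_pi].
  by exists (map strip_sequent pi'); rewrite map_rcons.
have sz : size pi1 < size (rcons pi' T).
  by rewrite -(size_map strip_sequent (rcons _ _)) def_pi size_cat /=; lia.
have split_pi := cat_take_drop (size pi1) (rcons pi' T).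
rewrite (drop_nth T) // in split_pi.
have def_pi1 : map strip_sequent (take (size pi1) (rcons pi' T)) = pi1.
  by rewrite map_take def_pi take_size_cat.
have def_T' : strip_sequent (nth T (rcons pi' T) (size pi1)) = T'.
  by rewrite -(nth_map T (strip_sequent T)) // def_pi nth_cat ltnn subnn.
have [hT|[ps sps rule_ps]] := rule_pi _ _ _ (esym split_pi).
  by left; rewrite -def_T'; exact: ext_hyp_strip.
right; exists (map strip_sequent ps).
  by move=> _ /mapP[T1 T1ps ->]; rewrite -def_pi1 map_f // sps.
by rewrite -def_T'; exact: LDT_strip.
Qed.

Lemma ext_proof_mono (r r' : seq sequent -> sequent -> Prop) E T pi :
  (forall ps S, r ps S -> r' ps S) -> ext_proof r E T pi -> ext_proof r' E T pi.
Proof.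
move=> rr' [last_pi rule_pi]; split=> // pi1 S pi2 /rule_pi[|[ps sps rS]].
  by left.
by right; exists ps => //; exact: rr'.
Qed.

(** * Sizes and logarithms *)

Lemma size_le_form_size (s : seq form) : size s <= \sum_(A <- s) form_size A.
Proof.
elim: s => [|A s IH]; rewrite ?big_nil // big_cons /= -add1n leq_add //.
by case: A => //= *; lia.
Qed.

(** Strictness comes from the arrow; it makes even an empty sequent count in
    [size_le_proof_size]. *)
Lemma size_le_sequent_size (T : sequent) :
  size T.1 + size T.2 < sequent_size T.
Proof.
have := size_le_form_size T.1; have := size_le_form_size T.2.
by rewrite /sequent_size; lia.
Qed.

Lemma size_le_proof_size (pi : seq sequent) : size pi <= proof_size pi.
Proof.
elim: pi => [|T pi IH]; rewrite /proof_size ?big_nil // big_cons /= -add1n.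
by rewrite leq_add // (leq_trans _ (size_le_sequent_size T)).
Qed.

Lemma sequent_size_le_proof_size (pi : seq sequent) T :
  T \in pi -> sequent_size T <= proof_size pi.
Proof. by move=> Tpi; rewrite /proof_size (big_rem _ Tpi) leq_addr. Qed.

Lemma trunc_log2_le_ln N : 0 < N ->
  (INR (trunc_log 2 N) * ln 2 <= ln (INR N))%R.
Proof.
move=> N_gt0; have /leP/le_INR := trunc_logP (isT : 1 < 2) N_gt0.
have -> : INR (2 ^ trunc_log 2 N) = (2 ^ trunc_log 2 N)%R.
  by elim: (trunc_log 2 N) => // n IH; rewrite expnS mult_INR IH.
have pow_gt0 : (0 < 2 ^ trunc_log 2 N)%R by apply: pow_lt; lra.
rewrite -ln_pow; last by lra.
by case=> [lt|->]; [left; exact: ln_increasing | right].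
Qed.

(** Here [168 = 24 * 7]: the truncated logarithm [t] is at least 1 because [2 <= N], so
    [t + 6 <= 7 * t]. *)
Lemma rounds_le_ln N d : 2 <= N -> d <= 24 * ((trunc_log 2 N).+1 + 5) ->
  (INR d <= 168 / ln 2 * ln (INR N))%R.
Proof.
move=> N_ge2 le_d; have log_gt0 : 0 < trunc_log 2 N by rewrite trunc_log_gt0.
have /leP/le_INR : d <= 168 * trunc_log 2 N by lia.
rewrite mult_INR (_ : INR 168 = 168%R); last by rewrite INR_IZR_INZ.
have ln2 : (0 < ln 2)%R by rewrite -ln_1; apply: ln_increasing; lra.
have := trunc_log2_le_ln (ltnW N_ge2).
move: (INR (trunc_log 2 N)) (ln (INR N)) => t l le_tl le_dt.
apply: Rle_trans le_dt _.
have -> : (168 * t = 168 / ln 2 * (t * ln 2))%R by field; lra.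
apply: Rmult_le_compat_l => //.
by apply: Rlt_le; apply: Rdiv_lt_0_compat; lra.
Qed.

(** * The round bound for both games *)

Theorem theorem4p1 :
  exists c : R,
    (forall (E Gamma Delta : seq form) (N : nat),
       ext_axioms E ->
       2 <= N ->
       (exists2 pi : seq sequent,
          eLNDT_proof E (Gamma, Delta) pi & proof_size pi = N) ->
       exists2 t : strategy,
         NB_winning E (initial_state Gamma Delta) t &
         Rle (INR (depth t)) (Rmult c (ln (INR N)))) /\
    (forall (E Gamma Delta : seq form) (N : nat),
       ext_axioms E ->
       all eDT E ->
       all eDT Gamma ->
       all eDT Delta ->
       2 <= N ->
       (exists2 pi : seq sequent,
          eLDT_proof E (Gamma, Delta) pi & proof_size pi = N) ->
       exists2 t : strategy,
         DB_winning E (initial_state Gamma Delta) t &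
         Rle (INR (depth t)) (Rmult c (ln (INR N)))).
Proof.
exists (168 / ln 2)%R; split=> [E G D N _ N_ge2|E G D N _ eE eG eD N_ge2] [pi prf szN].
(* With [k] equal to this exponent, [2 ^ k] bounds both the number of lines and the number of
   formulas in each line. *)
- have lt_N : N < 2 ^ (trunc_log 2 N).+1 by exact: trunc_log_ltn.
  have szpi := size_le_proof_size pi.
  have [] := @wins_strategy predT E (24 * ((trunc_log 2 N).+1 + 5))
    (initial_state G D).
    apply: ext_proof_wins prf _ _ => // [T Tpi|]; last by lia.
    split=> //; have := size_le_sequent_size T.
    by have := sequent_size_le_proof_size Tpi; lia.
  by move=> t wt /(rounds_le_ln N_ge2); exists t.
- have lt_N : N < 2 ^ (trunc_log 2 N).+1 by exact: trunc_log_ltn.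
  have szpi := size_le_proof_size pi.
  have strip_all s : all eDT s -> map strip s = s.
    by move=> /allP es; apply: map_id_in => A /es/strip_id.
  have {}prf := ext_proof_mono (@LNDT_LDT) (ext_proof_strip eE prf).
  (* The end sequent consists of eDT formulas, so stripping leaves it and the initial state
     unchanged. *)
  rewrite /strip_sequent /= !strip_all // in prf.
  have [] := @wins_strategy eDT E (24 * ((trunc_log 2 N).+1 + 5))
    (initial_state G D).
    apply: ext_proof_wins prf _ _ => // [_ /mapP[T Tpi ->]|].
      split=> [A|]; first by rewrite -map_cat => /mapP[B _ ->]; exact: eDT_strip.
      rewrite !size_map; have := size_le_sequent_size T.
      by have := sequent_size_le_proof_size Tpi; lia.
    by rewrite size_map; lia.
  by move=> t wt /(rounds_le_ln N_ge2); exists t.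
Qed.
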